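(* Let $(\mathbb{X},\|\cdot\|)$ be a real Banach space and let $f,g,h:\mathbb{X}\longrightarrow\mathbb{R}$ be quasidifferentiable at each point of $\mathbb{X}$, with $f$ and $g$ lower semicontinuous on $\mathbb{X}$, $h$ continuous on $\mathbb{X}$, and $f$ bounded from below on $\mathbb{X}$. Consider the problem $$\min_{x\in\mathbb{X}}f(x)\ \text{ subject to }\ g(x)\le 0,\ h(x)=0,\qquad(\mathcal{P}_c)$$ let $\Omega=\{x\in\mathbb{X}: g(x)\le 0,\ h(x)=0\}$ be its feasible region and let $\mathrm{Argmin}(f,\Omega)$ be the set of its global solutions. Suppose that (i) $\mathrm{Argmin}(f,\Omega)\ne\varnothing$; (ii) there exists $\tau>0$ such that $$\inf_{x\in\mathbb{X}\backslash\Omega}\ \mathrm{dist}\left(\mathbf{0}^*,\mathcal{D}^{\vartriangle}[g]_+(x)+\mathcal{D}^{\vartriangle}|h|(x)\right)\ge\tau;$$ (iii) $f$ is Lipschitz continuous on $\mathbb{X}$ with rank $\ell_f$; (iv) for some $\lambda>\ell_f$ and $\zeta>0$ it holds $$\inf_{x\in\mathbb{X}\backslash\mathrm{Argmin}(f,\Omega)}\mathrm{dist}\left(\mathbf{0}^*,\mathcal{D}^{\vartriangle}f(x)+\lambda\tau^{-1}\left(\mathcal{D}^{\vartriangle}[g]_+(x)+\mathcal{D}^{\vartriangle}|h|(x)\right)\right)\ge\zeta.$$ Then the solutions of $(\mathcal{P}_c)$ are constrained global weak sharp minimizers and $\mathrm{wsha}(f,\Omega)\ge\zeta$.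
   Context: $\mathbb{X}^*$ is the topological dual of $\mathbb{X}$ with null functional $\mathbf{0}^*$, and $\langle\cdot,\cdot\rangle$ is the duality pairing. In a normed space, $\mathrm{dist}(x,A)=\inf_{a\in A}\|x-a\|$, with $\mathrm{dist}(x,\varnothing)=+\infty$. For real $r$, $[r]_+=\max\{r,0\}$; $[g]_+$ is the function $x\mapsto[g(x)]_+$ and $|h|$ the function $x\mapsto|h(x)|$. $\mathcal{K}(\mathbb{X}^* )$ denotes the family of all nonempty, convex, weak* compact subsets of $\mathbb{X}^*$; for $A\in\mathcal{K}(\mathbb{X}^* )$ its support function is $\varsigma(v,A)=\max_{x^*\in A}\langle x^*,v\rangle$, $v\in\mathbb{X}$. Lipschitz with rank $\ell_f$ means $|f(x)-f(y)|\le\ell_f\|x-y\|$ for all $x,y\in\mathbb{X}$. Quasidifferentiability: a function $\varphi:\mathbb{X}\to\mathbb{R}$ is quasidifferentiable at $x$ if it admits a directional derivative $\varphi'(x;v)$ at $x$ in every direction $v$ and there exist $\underline{\partial}\varphi(x),\,-\overline{\partial}\varphi(x)\in\mathcal{K}(\mathbb{X}^* )$ such that $\varphi'(x;v)=\varsigma(v,\underline{\partial}\varphi(x))-\varsigma(v,-\overline{\partial}\varphi(x))$ for all $v\in\mathbb{X}$. If $g$ and $h$ are quasidifferentiable, so are $[g]_+$ and $|h|$. Demyanov difference: for $A,B\in\mathcal{K}(\mathbb{X}^* )$, $A\,\underline{\vartriangle}\,B=\partial^\circ\big(\varsigma(\cdot,A)-\varsigma(\cdot,B)\big)(\mathbf{0})$,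 where $\partial^\circ$ is the Clarke subdifferential and $\mathbf{0}$ the null vector of $\mathbb{X}$. Set $\mathcal{D}^{\vartriangle}\varphi(x)=\underline{\partial}\varphi(x)\,\underline{\vartriangle}\,(-\overline{\partial}\varphi(x))$; this set does not depend on the choice of the representing pair. Constrained weak sharpness: the solutions of $(\mathcal{P}_c)$ are constrained global weak sharp minimizers if $\mathrm{Argmin}(f,\Omega)\ne\varnothing$ and there exists $\sigma>0$ such that $\sigma\cdot\mathrm{dist}(x,\mathrm{Argmin}(f,\Omega))\le f(x)-\inf_{z\in\Omega}f(z)$ for every $x\in\Omega$. The supremum of all such $\sigma$ is denoted by $\mathrm{wsha}(f,\Omega)$. *)

(* Defs.v *)
From HB Require Import structures.
From mathcomp Require Import all_boot all_order all_algebra.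
From mathcomp Require Import all_classical all_reals all_analysis.

Set Implicit Arguments.
Unset Strict Implicit.
Unset Printing Implicit Defensive.

Import Order.TTheory GRing.Theory Num.Theory.
Import numFieldNormedType.Exports.

Local Open Scope classical_set_scope.
Local Open Scope ring_scope.

Section Dual.
Context {R : realType} {X : normedModType R}.
Implicit Types (p q : X -> R^o) (A B : set (X -> R^o)) (v : X).

(* Functionals are kept as plain functions, so that sums and multiples of them
   are those of the function space [X -> R^o]. *)
Definition topological_dual : set (X -> R^o) := [set p | linear p /\ continuous p].

Definition dual_norm p : \bar R :=
  ereal_sup [set `|p v|%:E | v in [set v | `|v| <= 1]].

Definition dual_dist p A : \bar R := ereal_inf [set dual_norm (p - q) | q in A].

Definition set_add A B : set (X -> R^o) := [set p + q | p in A & q in B].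

Definition set_scale (c : R) A : set (X -> R^o) := [set c *: p | p in A].

(* The weak* topology of the dual is induced by the topology of pointwise
   convergence on [X -> R^o], so a set of continuous functionals is weak*
   compact iff it is compact for the latter. *)
Definition weak_star_compact A := compact (A : set {ptws X -> R^o}).

Definition dual_cvx_compact : set (set (X -> R^o)) :=
  [set A | [/\ A !=set0, A `<=` topological_dual,
               convex_set (A : set (convex_lmodType (X -> R^o)))
             & weak_star_compact A]].

(* On [dual_cvx_compact] the supremum is attained. *)
Definition support_fun v A : R := sup [set p v | p in A].

End Dual.

Section Nonsmooth.
Context {R : realType} {X : normedModType R}.
Implicit Types (phi psi : X -> R) (A B : set (X -> R^o)) (x v : X).

Definition diff_quot phi x v (t : R) : R := (phi (x + t *: v) - phi x) / t.

Definition dir_derivable phi x v : Prop := cvg (diff_quot phi x v t @[t --> 0^'+]).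

Definition dir_derive phi x v : R := lim (diff_quot phi x v t @[t --> 0^'+]).

(* [B] is the negative of the superdifferential. *)
Definition quasidifferential phi x A B : Prop :=
  [/\ dual_cvx_compact A, dual_cvx_compact B, forall v, dir_derivable phi x v
    & forall v, dir_derive phi x v = support_fun v A - support_fun v B].

Definition quasidifferentiable phi x : Prop :=
  exists A B, quasidifferential phi x A B.

Definition clarke_derive psi x v : \bar R :=
  limf_esup (fun yt : X * R => (diff_quot psi yt.1 v yt.2)%:E)
    (filter_prod (nbhs x) (0^'+)).

Definition clarke_subdiff psi x : set (X -> R^o) :=
  [set p | topological_dual p /\ forall v, ((p v)%:E <= clarke_derive psi x v)%E].

Definition demyanov_diff A B : set (X -> R^o) :=
  clarke_subdiff (fun v => support_fun v A - support_fun v B) 0.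

(* Union over all representing pairs; every pair gives the same set, see
   [demyanov_quasidiffE]. *)
Definition demyanov_quasidiff phi x : set (X -> R^o) :=
  [set p | exists A B, quasidifferential phi x A B /\ demyanov_diff A B p].

Lemma demyanov_quasidiffE phi x A B :
  quasidifferential phi x A B -> demyanov_quasidiff phi x = demyanov_diff A B.
Proof.
move=> qAB; apply/seteqP; split=> [p [A' [B' [[_ _ _ q'] ]]]|p dp]; last first.
  by exists A, B.
rewrite /demyanov_diff (_ : (fun v => support_fun v A' - support_fun v B') =
  (fun v => support_fun v A - support_fun v B))//.
by apply/funext => v; case: qAB => _ _ _ <-; rewrite q'.
Qed.

End Nonsmooth.

Section Optimization.
Context {R : realType} {X : normedModType R}.
Implicit Types (f g h : X -> R) (Omega : set X).

Definition dist_set (x : X) (S : set X) : \bar R :=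
  ereal_inf [set `|x - a|%:E | a in S].

Definition feasible g h : set X := [set x | g x <= 0 /\ h x = 0].

Definition Argmin f Omega : set X :=
  [set x | Omega x /\ forall z, Omega z -> f x <= f z].

Definition sharp_moduli f Omega : set R :=
  [set sigma | 0 < sigma /\ forall x, Omega x ->
    (sigma%:E * dist_set x (Argmin f Omega) <=
       (f x)%:E - ereal_inf [set (f z)%:E | z in Omega])%E].

Definition weak_sharp_minimizers f Omega : Prop :=
  Argmin f Omega !=set0 /\ sharp_moduli f Omega !=set0.

Definition wsha f Omega : \bar R :=
  ereal_sup [set sigma%:E | sigma in sharp_moduli f Omega].

Definition pos_part g : X -> R := fun x => Num.max (g x) 0.

Definition abs_fun h : X -> R := fun x => `|h x|.

End Optimization.

(* Main.v *)
Require Import Defs.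
From HB Require Import structures.
From mathcomp Require Import all_boot all_order all_algebra.
From mathcomp Require Import all_classical all_reals all_analysis.
From mathcomp Require Import lra.

Import Order.TTheory GRing.Theory Num.Theory.
Import numFieldNormedType.Exports.

Local Open Scope classical_set_scope.
Local Open Scope ring_scope.

Set Implicit Arguments.
Unset Strict Implicit.
Unset Printing Implicit Defensive.

(** Write [r = [g]_+ + |h|], a nonnegative function vanishing exactly on the
    feasible set, and [phi = f + (lambda / tau) r]. Everything rests on one
    principle, [subdiff_error_bound]: if [phi >= m] is lower semicontinuous and
    its subdifferential stays at distance at least [tau] from [0] at every point
    outside a set [S], then [tau * dist x S <= phi x - m]. Indeed, were it to
    fail at [x], Ekeland's principle would give a point [y] outside [S] and a
    [sigma < tau] such that [phi + sigma * `|. - y|] is minimal at [y]; the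
    directional derivative at [y] is then at least [- sigma * `|v|], and the
    subdifferential contains a functional of norm at most [sigma].

    Applied to [r] and the feasible set, with [m = 0], the principle gives [tau
    * dist x Omega <= r x]. As [f] is Lipschitz with rank less than [lambda],
    [phi] is then at least the minimal value [m] of [f] on the feasible set
    ([exact_penalty]). Applied to [phi], this [m] and the solution set, it gives
    [zeta * dist x Argmin <= phi x - m], and [phi x = f x] at feasible points.

    The sum rule needed for [phi] is proved at the level of directional
    derivatives. The directional derivative of a quasidifferentiable function is
    a difference of two continuous sublinear functionals, and the Clarke
    derivative at the origin of such a difference [psi] is at least [S v = sup_z
    (psi (z + v) - psi z)], which is sublinear and above [psi]. A linear
    functional below a sum of two sublinear functionals splits accordingly, by
    the sandwich form of the Hahn-Banach theorem ([linear_sandwich]), which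
    yields a sum rule without limits ([subdiff_majorantD]). The same Hahn-Banach
    theorem, together with the theorems of Tychonoff and Banach-Steinhaus,
    identifies the support functions of weak* compact convex sets with the
    continuous sublinear functionals, from which the quasidifferentiability of
    [[g]_+] and [|h|] follows ([quasidifferentiableP]). *)

(** * Sublinear functionals and the Hahn-Banach theorem *)

Section HahnBanach.
Context {R : realType} {V : lmodType R}.
Implicit Types (s S T p q : V -> R) (K : set V) (u v w : V).

Definition sublinear s : Prop :=
  (forall u v, s (u + v) <= s u + s v) /\
  (forall t v, 0 <= t -> s (t *: v) = t * s v).

Lemma sublinear0 {s} : sublinear s -> s 0 = 0.
Proof. by case=> _ sZ; rewrite -(scale0r 0) sZ// mul0r. Qed.

Lemma sublinear_ge {s} u v : sublinear s -> s u - s v <= s (u - v).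
Proof. by case=> sD _; rewrite lerBlDr -{1}(subrK v u) sD. Qed.

Lemma sublinear_geN {s} v : sublinear s -> - s (- v) <= s v.
Proof.
by move=> ss; have := sublinear_ge 0 (- v) ss; rewrite opprK add0r sublinear0// sub0r.
Qed.

(** Scaling by [t^-1] turns the inequality into the reverse one. *)
Lemma sublinearW s : s 0 = 0 -> (forall u v, s (u + v) <= s u + s v) ->
  (forall t v, 0 < t -> s (t *: v) <= t * s v) -> sublinear s.
Proof.
move=> s0 sD sZ; split=> // t v; rewrite le_eqVlt => /predU1P[<-|t0].
  by rewrite scale0r mul0r.
apply/eqP; rewrite eq_le sZ//= mulrC -ler_pdivlMr// mulrC.
have /(sZ _ (t *: v)) : 0 < t^-1 by rewrite invr_gt0.
by rewrite scalerA mulVf ?gt_eqF// scale1r.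
Qed.

Definition convex_cone K : Prop :=
  [/\ K 0, forall u v, K u -> K v -> K (u + v)
    & forall t v, 0 < t -> K v -> K (t *: v)].

(** The functional [q v = inf_(w in K) (S (v + w) + T w)]; it is finite because
    [S (v + w) >= S w - S (- v)] and [S + T >= 0] on [K]. With [K] a ray it is
    the step that makes minimal sublinear functionals odd, and with [K] the
    whole space it is the sandwich theorem behind the sum rule. *)
Lemma cone_sandwich S T K : sublinear S -> convex_cone K ->
    (forall u v, K u -> K v -> T (u + v) <= T u + T v) ->
    (forall t v, 0 < t -> K v -> T (t *: v) <= t * T v) -> T 0 <= 0 ->
    (forall w, K w -> 0 <= S w + T w) ->
  exists q, [/\ sublinear q, forall v, q v <= S v
               & forall w, K w -> q (- w) <= T w].
Proof.
move=> sS [K0 KD KZ] TD TZ T0 ST.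
pose E v := [set S (v + w) + T w | w in K].
have Eneq0 v : E v !=set0 by exists (S (v + 0) + T 0), 0.
have Elb v : lbound (E v) (- S (- v)).
  move=> _ [w Kw <-]; rewrite -sub0r lerBlDr (le_trans (ST w Kw))// addrAC lerD2r.
  by rewrite -{1}(addKr v w) addrC; case: sS => + _; apply.
have Ein v w : K w -> inf (E v) <= S (v + w) + T w.
  by move=> Kw; apply: ge_inf; [exists (- S (- v)); exact: Elb|exists w].
have qS v : inf (E v) <= S v.
  by rewrite (le_trans (Ein v 0 K0))// addr0 gerDl.
have S0 := sublinear0 sS.
exists (fun v => inf (E v)); split=> //; last first.
  by move=> w Kw; rewrite (le_trans (Ein _ w Kw))// addNr S0 add0r.
apply: sublinearW.
- apply/eqP; rewrite eq_le -{1}S0 qS/=.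
  by apply: lb_le_inf => //; have := Elb 0; rewrite oppr0 S0 oppr0.
- move=> u v; rewrite -lerBlDr; apply: lb_le_inf => // _ [w Kw <-].
  rewrite lerBlDr [leRHS]addrC -lerBlDr; apply: lb_le_inf => // _ [w' Kw' <-].
  rewrite lerBlDr (le_trans (Ein _ (w' + w) (KD _ _ Kw' Kw)))//.
  rewrite (_ : u + v + (w' + w) = (v + w') + (u + w)); last first.
    by rewrite (addrC u) addrACA.
  have := TD _ _ Kw' Kw; have [/(_ (v + w') (u + w)) + _] := sS.
  by lra.
- move=> t v t0; rewrite mulrC -ler_pdivrMr//; apply: lb_le_inf => // _ [w Kw <-].
  rewrite ler_pdivrMr// (le_trans (Ein _ (t *: w) (KZ _ _ t0 Kw)))//.
  by rewrite -scalerDr (sS.2 _ _ (ltW t0)) mulrDl mulrC lerD2l mulrC TZ.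
Qed.

Definition ray v : set V := [set t *: v | t in [set t : R | 0 <= t]].

Lemma ray_convex_cone v : convex_cone (ray v).
Proof.
split=> [|_ _ [a a0 <-] [b b0 <-]|t _ t0 [a a0 <-]].
- by exists 0 => //=; rewrite scale0r.
- by exists (a + b); rewrite ?scalerDl//= addr_ge0.
- by exists (t * a); rewrite ?scalerA//= mulr_ge0// ltW.
Qed.

(** Lowering [s] in the direction [- v] until it is odd on the line through [v]:
    on the ray of [v] the functional [- s] is additive, and [cone_sandwich]
    applies to it. *)
Lemma sublinear_ray s v : sublinear s ->
  exists q, [/\ sublinear q, forall u, q u <= s u & q (- v) <= - s v].
Proof.
move=> ss; have [||||q [sq qs qT]] :=
    @cone_sandwich s (fun u => - s u) (ray v) ss (ray_convex_cone v).
- move=> _ _ [a a0 <-] [b b0 <-]; rewrite -scalerDl !ss.2 ?addr_ge0//.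
  by rewrite mulrDl opprD.
- by move=> t _ t0 [a a0 <-]; rewrite (ss.2 t _ (ltW t0)) mulrN.
- by rewrite (sublinear0 ss) oppr0.
- by move=> w _; rewrite subrr.
- by exists q; split=> //; apply: qT; exists 1; rewrite ?scale1r//=.
Qed.

(** Zorn's lemma: a chain of sublinear functionals below [s] has its pointwise
    infimum as a lower bound, finite because each member is at least [- s (- v)]
    at [v]. *)
Lemma minimal_sublinear s : sublinear s ->
  exists p, [/\ sublinear p, forall v, p v <= s v &
    forall q, sublinear q -> (forall v, q v <= p v) -> q = p].
Proof.
move=> ss.
pose P := {p : V -> R | sublinear p /\ forall v, p v <= s v}.
pose le (p q : P) := `[< forall v, sval q v <= sval p v >].
have [||||[p [sp ps]] pmin] := @Zorn P le.
- by move=> p; apply/asboolP.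
- move=> p q r /asboolP pq /asboolP qr; apply/asboolP => v.
  exact: le_trans (pq v).
- move=> [p hp] [q hq] /asboolP /= pq /asboolP /= qp.
  have eqpq : p = q by apply/funext => v; apply/eqP; rewrite eq_le pq qp.
  by subst q; congr exist; exact: Prop_irrelevance.
- move=> A Atot.
  have [[a Aa]|A0] := pselect (A !=set0); last first.
    by exists (exist _ s (conj ss (fun=> lexx _))) => q Aq; case: A0; exists q.
  pose E v := [set sval p v | p in A].
  have Eneq0 v : E v !=set0 by exists (sval a v), a.
  have Elb v : lbound (E v) (- s (- v)).
    move=> _ [[p [sp ps]] Ap <-] /=.
    by rewrite (le_trans _ (sublinear_geN _ sp))// lerN2.
  have Ein v (p : P) : A p -> inf (E v) <= sval p v.
    by move=> Ap; apply: ge_inf; [exists (- s (- v)); exact: Elb|exists p].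
  have sE : sublinear (fun v => inf (E v)).
    apply: sublinearW.
    + apply/eqP; rewrite eq_le (le_trans (Ein _ _ Aa)) ?(sublinear0 (proj1 (svalP a)))//=.
      by apply: lb_le_inf => //; have := Elb 0; rewrite oppr0 (sublinear0 ss) oppr0.
    + move=> u v; rewrite -lerBlDr; apply: lb_le_inf => // _ [p Ap <-].
      rewrite lerBlDr [leRHS]addrC -lerBlDr; apply: lb_le_inf => // _ [q Aq <-].
      rewrite lerBlDr.
      have [r [Ar rp rq]] : exists r,
          [/\ A r, sval r u <= sval p u & sval r v <= sval q v].
        by have [/asboolP pq|/asboolP qp] := Atot _ _ Ap Aq; [exists q|exists p].
      rewrite (le_trans (Ein _ _ Ar))// (le_trans (proj1 (proj1 (svalP r)) _ _))//.
      by rewrite addrC lerD.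
    + move=> t v t0; rewrite mulrC -ler_pdivrMr//.
      apply: lb_le_inf => // _ [p Ap <-]; rewrite ler_pdivrMr//.
      by rewrite (le_trans (Ein _ _ Ap))// (proj2 (proj1 (svalP p)) _ _ (ltW t0)) mulrC.
  have Es v : inf (E v) <= s v by rewrite (le_trans (Ein _ _ Aa))// (proj2 (svalP a)).
  pose t : P := exist _ (fun v => inf (E v)) (conj sE Es).
  by exists t => p Ap; apply/asboolP => v /=; exact: Ein.
exists p; split=> // q sq qp.
have qs v : q v <= s v by exact: le_trans (ps v).
pose q' : P := exist _ q (conj sq qs).
have /(pmin q') : le (exist _ p (conj sp ps)) q' by apply/asboolP.
by move=> /(congr1 sval).
Qed.

(** A minimal sublinear functional cannot be lowered by [sublinear_ray], hence
    it is odd, and an odd sublinear functional is linear. Starting from a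
    sublinear functional instead of a partial linear one makes this form of the
    Hahn-Banach theorem free of extension arguments. *)
Lemma sublinear_linear s : sublinear s ->
  exists2 p, linear (p : V -> R^o) & forall v, p v <= s v.
Proof.
move=> /minimal_sublinear[p [sp ps pmin]]; exists p => //.
have pN v : p (- v) = - p v.
  have [q [sq qp qv]] := sublinear_ray v sp.
  have qE := pmin _ sq qp; apply/eqP; rewrite eq_le -{1}qE qv/=.
  by rewrite lerNl; exact: sublinear_geN.
have pD u v : p (u + v) = p u + p v.
  apply/eqP; rewrite eq_le sp.1/= -{1}(opprK v).
  by have := sublinear_ge u (- v) sp; rewrite pN !opprK.
move=> t u v; rewrite pD; congr (_ + _).
have [t0|t0] := leP 0 t; first by rewrite sp.2.
by rewrite -[t]opprK scaleNr pN sp.2 ?oppr_ge0 ?ltW// [RHS]scaleNr.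
Qed.

(** A linear functional below the sublinear one of [cone_sandwich]. *)
Lemma linear_sandwich S T K : sublinear S -> convex_cone K ->
    (forall u v, K u -> K v -> T (u + v) <= T u + T v) ->
    (forall t v, 0 < t -> K v -> T (t *: v) <= t * T v) -> T 0 <= 0 ->
    (forall w, K w -> 0 <= S w + T w) ->
  exists p, [/\ linear (p : V -> R^o), forall v, p v <= S v
               & forall w, K w -> p (- w) <= T w].
Proof.
move=> sS cK TD TZ T0 ST.
have [q [sq qS qT]] := cone_sandwich sS cK TD TZ T0 ST.
have [p lp pq] := sublinear_linear sq.
exists p; split=> // [v|w Kw]; first exact: le_trans (qS v).
exact: le_trans (qT w Kw).
Qed.
End HahnBanach.

(** * Weak* compact convex sets and their support functions *)

Section WeakStar.
Context {R : realType} {X : normedModType R}.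
Implicit Types (s : X -> R) (p q : X -> R^o) (u v : X).

(** The continuous sublinear functionals; over a Banach space they are exactly
    the support functions of the members of [dual_cvx_compact], see
    [support_fun_minorants] and [support_fun_bounded_sublinear]. *)
Definition bounded_sublinear s : Prop :=
  sublinear s /\ exists L, forall v, s v <= L * `|v|.

Definition pack_linear p (lp : linear p) : {linear X -> R^o} :=
  HB.pack p (GRing.isLinear.Build _ _ _ _ _ lp).

Lemma linear_oppE p v : linear p -> p (- v) = - p v.
Proof. by move=> lp; rewrite -[p]/(pack_linear lp : _ -> _) linearN. Qed.

Lemma dominated_norm p L : linear p -> (forall v, p v <= L * `|v|) ->
  forall v, `|p v| <= L * `|v|.
Proof.
move=> lp pL v; rewrite ler_norml pL andbT lerNl.
by rewrite -linear_oppE// (le_trans (pL _))// normrN.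
Qed.

Lemma dominated_dual p L : linear p -> (forall v, p v <= L * `|v|) ->
  topological_dual p.
Proof.
move=> lp pL; split=> //.
suff : continuous (pack_linear lp) by [].
apply: bounded_linear_continuous; apply/linear_boundedP.
exists L; split; first exact: num_real.
move=> M LM v; rewrite (le_trans (dominated_norm lp pL v))//.
by rewrite ler_wpM2r// ltW.
Qed.

Definition minorants s : set (X -> R^o) :=
  [set p : X -> R^o | linear p /\ forall v, p v <= s v].

(** The Banach-Alaoglu argument: the minorants of [s] form a pointwise closed
    part of the product of the segments [[- s (- v), s v]]. *)
Lemma minorants_weak_star_compact s : weak_star_compact (minorants s).
Proof.
pose B : set {ptws X -> R^o} :=
  [set p | forall v, (`[- s (- v), s v]%classic : set R^o) (p v)].
have cB : compact B.
  exact: (@tychonoff X (fun _ => R^o) (fun v => `[- s (- v), s v]%classic)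
                     (fun v => @segment_compact R _ _)).
apply: (subclosed_compact _ cB); last first.
  move=> p [lp ps] v /=; rewrite in_itv/= ps andbT lerNl.
  by have := ps (- v); rewrite linear_oppE.
have -> : (minorants s : set {ptws X -> R^o}) =
  (\bigcap_(tuv in [set: R * X * X])
    [set p : {ptws X -> R^o} |
       (p (tuv.1.1 *: tuv.1.2 + tuv.2) : R) - tuv.1.1 * p tuv.1.2 - p tuv.2 = 0]) `&`
  (\bigcap_(v in [set: X]) [set p : {ptws X -> R^o} | p v <= s v]).
  apply/seteqP; split=> [p [lp ps]|p [lp ps]].
    split=> [[[t u] v] _ /=|v _ /=]; last exact: ps.
    by rewrite lp -addrA -opprD subrr.
  split=> [t u v|v]; last exact: (ps v I).
  have /= := lp ((t, u), v) I.
  by rewrite -addrA -opprD => /eqP; rewrite subr_eq0 => /eqP.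
have evc v : continuous (fun p : {ptws X -> R^o} => p v : R).
  exact: (@proj_continuous X (fun _ => R^o) v).
apply: closedI; apply: closed_bigI.
- move=> [[t u] v] _ /=.
  apply: (@closed_comp _ _ (fun p : {ptws X -> R^o} =>
    (p (t *: u + v) : R) - t * p u - p v) [set 0 : R]).
    move=> p _.
    have h w := evc w p.
    have Fp : Filter (nbhs p) by exact: nbhs_filter.
    have h1 : (fun q : {ptws X -> R^o} => t * (q u : R)) x @[x --> nbhs p] -->
        t * (p u : R).
      by apply: cvgM; [exact: cvg_cst|exact: h].
    have h2 := @cvgB _ _ _ _ Fp _ _ _ _ (h (t *: u + v)) h1.
    have h3 := @cvgB _ _ _ _ Fp _ _ _ _ h2 (h v).
    exact: h3.
  exact: closed_eq.
- move=> v _ /=.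
  apply: (@closed_comp _ _ (fun p : {ptws X -> R^o} => p v : R)
    [set x : R | x <= s v]).
    by move=> p _; exact: evc.
  exact: closed_le.
Qed.

Lemma minorants_dual_cvx_compact s : bounded_sublinear s ->
  dual_cvx_compact (minorants s).
Proof.
move=> [ss [L sL]]; split.
- by have [p lp ps] := sublinear_linear ss; exists p.
- by move=> p [lp ps]; apply: (@dominated_dual p L) => // v; exact: le_trans (ps v) _.
- apply/convex_setW => p q; rewrite !inE => -[lp ps] [lq qs] k k0 k1.
  have convE v : (conv k (p : convex_lmodType (X -> R^o)) q : X -> R^o) v
      = k%:num * p v + (1 - k%:num) * q v by [].
  apply/mem_set; split=> [t u v|v]; rewrite !convE.
    by rewrite lp lq /GRing.scale/=; lra.
  have := ps v; have := qs v.
  by move: (p v : R) (q v : R) => a b ? ?; nra.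
- exact: minorants_weak_star_compact.
Qed.

(** By Hahn-Banach some minorant [p] satisfies [p (- v) <= - s v], so that it
    agrees with [s] at [v]. *)
Lemma support_fun_minorants s v : bounded_sublinear s ->
  support_fun v (minorants s) = s v.
Proof.
move=> [ss _].
have [q [sq qs qv]] := sublinear_ray v ss.
have [p lp pq] := sublinear_linear sq.
have pv : p v = s v.
  apply/eqP; rewrite eq_le (le_trans (pq v))//= -lerN2 -linear_oppE//.
  exact: le_trans (pq _) qv.
apply/eqP; rewrite eq_le; apply/andP; split.
  apply: sup_le_ub => [|_ [p' [_ p's] <-]//].
  by exists (p v), p => //; split=> // w; exact: le_trans (pq w) _.
rewrite -pv; apply: ub_le_sup; last first.
  by exists p => //; split=> // w; exact: le_trans (pq w) _.
by exists (s v) => _ [p' [_ p's] <-].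
Qed.
End WeakStar.

Section UniformBoundedness.
Context {R : realType} {X : completeNormedModType R}.

(** A weak* compact set is pointwise bounded, so completeness and the
    Banach-Steinhaus theorem bound it in norm. *)
Lemma support_fun_bounded_sublinear (A : set (X -> R^o)) :
  dual_cvx_compact A -> bounded_sublinear (support_fun ^~ A).
Proof.
move=> [A0 Adual _ Acomp].
have pb : pointwise_bounded A.
  move=> x.
  have cimg : compact ((fun p : {ptws X -> R^o} => (p x : R^o)) @` A).
    apply: (@continuous_compact {ptws X -> R^o} R^o (fun p => p x) A) => //.
    apply: continuous_subspaceT.
    exact: (@proj_continuous X (fun _ => R^o) x).
  have [M [_ HM]] := compact_bounded cimg.
  by exists (M + 1) => p Ap; apply: (HM (M + 1)); [rewrite ltrDl|exists p].
have /Banach_Steinhauss : forall p, A p -> bounded_fun_norm p /\ linear p.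
  move=> p /Adual[lp cp]; split=> //.
  have /linear_bounded_continuous/linear_boundedP[M [_ HM]] :
    continuous (pack_linear lp) by [].
  have {}HM : forall v, `|p v| <= (`|M| + 1) * `|v|.
    by apply: HM; rewrite (le_lt_trans (ler_norm M))// ltrDl.
  move=> r; exists ((`|M| + 1) * r) => v vr.
  by rewrite (le_trans (HM v))// ler_wpM2l// addr_ge0.
move=> /(_ pb 1)[M HM].
have pD p u v : A p -> p (u + v) = p u + p v.
  by move=> /Adual[lp _]; rewrite -[p]/(pack_linear lp : _ -> _) linearD.
have pZ p t v : A p -> p (t *: v) = t * p v.
  by move=> /Adual[lp _]; rewrite -[p]/(pack_linear lp : _ -> _) linearZ.
have pM p v : A p -> p v <= M * `|v|.
  move=> Ap; have [->|v0] := eqVneq v 0.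
    by rewrite -(scale0r 0) pZ// mul0r scale0r normr0 mulr0.
  rewrite -[v in p v](scalerKV (_ : `|v| != 0)) ?normr_eq0// pZ// mulrC.
  rewrite ler_wpM2r// (le_trans (ler_norm _))// (HM _ Ap)//.
  by rewrite normrZ normfV normr_id mulVf// normr_eq0.
have sge p v : A p -> p v <= support_fun v A.
  move=> Ap; apply: ub_le_sup; last by exists p.
  by exists (M * `|v|) => _ [q Aq <-]; exact: pM.
have sle v c : (forall p, A p -> p v <= c) -> support_fun v A <= c.
  move=> Ac; apply: sup_le_ub; first by have [p Ap] := A0; exists (p v), p.
  by move=> _ [p Ap <-]; exact: Ac.
split; last by exists M => v; apply: sle => p; exact: pM.
apply: sublinearW.
- have [p Ap] := A0; have p0 q : A q -> q 0 = 0.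
    by move=> Aq; rewrite -(scale0r 0) pZ// mul0r.
  by apply/eqP; rewrite eq_le -{2}(p0 p Ap) sge// andbT sle// => q Aq; rewrite p0.
- by move=> u v; apply: sle => p Ap; rewrite pD// lerD// sge.
- by move=> t v t0; apply: sle => p Ap; rewrite pZ// ler_pM2l// sge.
Qed.
End UniformBoundedness.

(** * Calculus of quasidifferentiable functions *)

Section DirectionalDerivative.
Context {R : realType} {X : normedModType R}.
Implicit Types (s : X -> R) (phi psi : X -> R) (x u v : X).

Lemma bounded_sublinearD s1 s2 : bounded_sublinear s1 -> bounded_sublinear s2 ->
  bounded_sublinear (s1 \+ s2).
Proof.
move=> [[sD1 sZ1] [L1 b1]] [[sD2 sZ2] [L2 b2]]; split; [split=> [u v|t v t0] /=|].
- by rewrite addrACA lerD.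
- by rewrite sZ1// sZ2// mulrDr.
- by exists (L1 + L2) => v /=; rewrite mulrDl lerD.
Qed.

Lemma bounded_sublinear_max s1 s2 : bounded_sublinear s1 -> bounded_sublinear s2 ->
  bounded_sublinear (s1 \max s2).
Proof.
move=> [[sD1 sZ1] [L1 b1]] [[sD2 sZ2] [L2 b2]]; split; [split=> [u v|t v t0] /=|].
- rewrite ge_max; apply/andP; split.
    by rewrite (le_trans (sD1 _ _))// lerD// le_max lexx.
  by rewrite (le_trans (sD2 _ _))// lerD// le_max lexx orbT.
- by rewrite sZ1// sZ2// maxr_pMr.
- exists (Num.max L1 L2) => v /=; rewrite maxr_pMl//.
  by rewrite ge_max !le_max b1 b2 orbT.
Qed.

Lemma bounded_sublinear0 : bounded_sublinear (fun _ : X => 0 : R).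
Proof.
split; [split=> [u v|t v t0]|exists 0 => v]; rewrite ?addr0 ?mulr0 ?mul0r//.
Qed.

Definition sublinear_diff psi : Prop := exists s1 s2,
  [/\ bounded_sublinear s1, bounded_sublinear s2 & psi = s1 \- s2].

Definition has_dir_derivative phi x psi : Prop :=
  forall v, diff_quot phi x v t @[t --> 0^'+] --> psi v.

Lemma diff_quotD phi1 phi2 x v :
  diff_quot (phi1 \+ phi2) x v = diff_quot phi1 x v \+ diff_quot phi2 x v.
Proof.
by apply/funext => t; rewrite /diff_quot /= -mulrDl; congr (_ / _); lra.
Qed.

Lemma has_dir_derivative_cvg phi x psi v : has_dir_derivative phi x psi ->
  phi (x + t *: v) @[t --> 0^'+] --> phi x.
Proof.
move=> /(_ v) dphi.
have t0 : (t : R) @[t --> (0:R)^'+] --> (0 : R) by exact: cvg_at_right_filter.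
have limphi : t * diff_quot phi x v t + phi x @[t --> 0^'+] --> phi x.
  rewrite -[X in _ --> X]add0r -[X in _ --> X + _](mul0r (psi v)).
  by apply: cvgD; [exact: cvgM|exact: cvg_cst].
apply: (cvg_trans _ limphi); apply: near_eq_cvg; near=> t.
rewrite /= /diff_quot mulrC divfK ?subrK//.
Unshelve. all: by end_near. Qed.

Lemma has_dir_derivative_near phi1 phi2 x psi :
  (forall v, \forall t \near 0^'+, phi1 (x + t *: v) = phi2 (x + t *: v)) ->
  phi1 x = phi2 x -> has_dir_derivative phi1 x psi -> has_dir_derivative phi2 x psi.
Proof.
move=> e12 ex d1 v; apply: cvg_trans (d1 v); apply: near_eq_cvg.
by apply: filterS (e12 v) => t; rewrite /diff_quot ex => ->.
Qed.

End DirectionalDerivative.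

Section Quasidifferentiable.
Context {R : realType} {X : completeNormedModType R}.
Implicit Types (phi g h : X -> R) (x v : X).

(** Sets of functionals are traded for sublinear functionals: support functions
    of members of [dual_cvx_compact] are continuous sublinear, and conversely a
    continuous sublinear functional supports the set of its minorants. Closure
    properties of quasidifferentiability thereby become identities between
    functions, with no convex hull or Minkowski sum to be shown compact. *)
Lemma quasidifferentiableP phi x : quasidifferentiable phi x <->
  exists2 psi, sublinear_diff psi & has_dir_derivative phi x psi.
Proof.
split=> [[A [B [cA cB dphi derE]]]|[_ [s1 [s2 [b1 b2 ->]] dphi]]].
  exists (fun v => support_fun v A - support_fun v B) => [|v].
    exists (support_fun ^~ A), (support_fun ^~ B).
    by split=> //; exact: support_fun_bounded_sublinear.
  by rewrite -derE; exact: dphi.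
exists (minorants s1), (minorants s2); split.
- exact: minorants_dual_cvx_compact.
- exact: minorants_dual_cvx_compact.
- by move=> v; apply/cvg_ex; exists ((s1 \- s2) v); exact: dphi.
- by move=> v; rewrite !support_fun_minorants//; apply: cvg_lim => //; exact: dphi.
Qed.

Lemma quasidifferentiableN phi x : quasidifferentiable phi x ->
  quasidifferentiable (\- phi) x.
Proof.
move=> /quasidifferentiableP[_ [s1 [s2 [b1 b2 ->]]] dphi]; apply/quasidifferentiableP.
exists (s2 \- s1) => [|v]; first by exists s2, s1.
rewrite (_ : diff_quot _ _ _ = \- diff_quot phi x v); last first.
  by apply/funext => t; rewrite /diff_quot /= -mulNr; congr (_ / _); lra.
rewrite (_ : (s2 \- s1) v = - (s1 \- s2) v); last by rewrite /= opprB.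
by apply: cvgN; exact: dphi.
Qed.

Lemma quasidifferentiableD phi1 phi2 x : quasidifferentiable phi1 x ->
  quasidifferentiable phi2 x -> quasidifferentiable (phi1 \+ phi2) x.
Proof.
move=> /quasidifferentiableP[_ [s1 [s2 [b1 b2 ->]]] dphi1].
move=> /quasidifferentiableP[_ [s3 [s4 [b3 b4 ->]]] dphi2]; apply/quasidifferentiableP.
exists ((s1 \- s2) \+ (s3 \- s4)) => [|v].
  exists (s1 \+ s3), (s2 \+ s4); split; try exact: bounded_sublinearD.
  by apply/funext => v /=; lra.
by rewrite diff_quotD; apply: cvgD; [exact: dphi1|exact: dphi2].
Qed.

(** Only the sign of [g x] matters, since [g] tends to [g x] along rays. At a
    zero of [g] the derivative of [[g]_+] is the positive part of [s1 - s2],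
    which is [max s1 s2 - s2]. *)
Lemma quasidifferentiable_pos_part g x : quasidifferentiable g x ->
  quasidifferentiable (pos_part g) x.
Proof.
move=> /quasidifferentiableP[psi dpsi dg]; apply/quasidifferentiableP.
have gc v := has_dir_derivative_cvg v dg.
have [g0|g0|g0] := ltgtP (g x) 0.
- exists (fun=> 0).
    exists (fun=> 0), (fun=> 0); split; try exact: bounded_sublinear0.
    by apply/funext => v /=; rewrite subr0.
  apply: (@has_dir_derivative_near _ _ (fun=> 0)) => [v||v].
  + have : \forall t \near 0^'+, g (x + t *: v) < 0 by exact: (cvgr_lt _ (gc v)).
    by apply: filterS => t gt; rewrite /pos_part max_r// ltW.
  + by rewrite /pos_part max_r// ltW.
  + rewrite (_ : diff_quot _ _ _ = cst 0) ?subrr//; first exact: cvg_cst.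
    by apply/funext => t; rewrite /diff_quot subrr mul0r.
- exists psi => //; apply: (@has_dir_derivative_near _ _ g) => // [v|].
  + have : \forall t \near 0^'+, 0 < g (x + t *: v) by exact: (cvgr_gt _ (gc v)).
    by apply: filterS => t gt; rewrite /pos_part max_l// ltW.
  + by rewrite /pos_part max_l// ltW.
- case: dpsi => s1 [s2 [b1 b2 psiE]].
  exists (psi \max (fun=> 0)).
    exists (s1 \max s2), s2; split=> //; first exact: bounded_sublinear_max.
    by apply/funext => v; rewrite psiE /= addr_maxl subrr.
  have cmax : continuous (fun a : R => Num.max a 0).
    by apply: max_fun_continuous => a; [exact: cvg_id|exact: cvg_cst].
  move=> v; have /= limg := cvg_comp _ _ (dg v) (cmax (psi v)).
  apply: cvg_trans limg; apply: near_eq_cvg; near=> t.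
  rewrite /diff_quot /= /pos_part g0 maxxx !subr0 maxr_pMl ?mul0r//.
  by rewrite invr_ge0 ltW//; near: t; exact: nbhs_right_gt.
Unshelve. all: by end_near. Qed.

(** [|h|] is the sum of the positive parts of [h] and of [- h]. *)
Lemma quasidifferentiable_abs_fun h x : quasidifferentiable h x ->
  quasidifferentiable (abs_fun h) x.
Proof.
move=> qh; rewrite (_ : abs_fun h = pos_part h \+ pos_part (\- h)).
  apply: quasidifferentiableD; apply: quasidifferentiable_pos_part => //.
  exact: quasidifferentiableN.
apply/funext => y; rewrite /abs_fun /pos_part /= /Num.max.
by case: ltrgt0P => //; do ?case: ifP; lra.
Qed.

End Quasidifferentiable.

(** * Clarke subdifferentials and the sum rule *)

Section ClarkeSubdifferential.
Context {R : realType} {X : normedModType R}.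
Implicit Types (S T phi psi : X -> R) (p : X -> R^o) (x u v z : X)
  (A B : set (X -> R^o)).

(** For a positively homogeneous [psi] the quotient at the base point [t *: z]
    with step [t] does not depend on [t], and these base points tend to the
    origin. *)
Lemma limf_esup_diff_quot psi v z :
  (forall t u, 0 <= t -> psi (t *: u) = t * psi u) ->
  ((psi (z + v) - psi z)%R%:E <= clarke_derive psi 0%R v)%E.
Proof.
move=> psiZ; apply: le_ereal_inf_tmp => _ [W [[P Q] /= [P0 Q0] PQW] <-].
have tz0 : t *: z @[t --> (0:R)^'+] --> (0 : X).
  rewrite -(scale0r z); apply: cvgZr_tmp; apply: cvg_at_right_filter.
  exact: cvg_id.
have [t [t0 Qt Pt]] : exists t : R, [/\ 0 < t, Q t & P (t *: z)].
  near (0:R)^'+ => t; exists t; split; near: t => //.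
  exact: nbhs_right_gt.
  exact: tz0.
apply: ereal_sup_ubound; exists (t *: z, t); first exact: PQW.
congr (_%:E); rewrite /diff_quot /= -scalerDr !psiZ ?ltW// -mulrBr mulrC.
by rewrite mulKf// gt_eqF.
Unshelve. all: by end_near. Qed.

(** The sublinear majorant is [S v = sup_z (psi (z + v) - psi z)]. It is bounded
    by [s1 v + s2 (- v)] when [psi = s1 - s2], its subadditivity is a
    telescoping sum, and [limf_esup_diff_quot] puts it below the Clarke
    derivative. *)
Lemma sublinear_diff_clarke psi : sublinear_diff psi -> exists S,
  [/\ bounded_sublinear S, forall v, psi v <= S v
    & forall v, ((S v)%:E <= clarke_derive psi 0%R v)%E].
Proof.
case=> [s1 [s2 [[ss1 [L1 b1]] [ss2 [L2 b2]] psiE]]].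
have psiZ t u : 0 <= t -> psi (t *: u) = t * psi u.
  by move=> t0; rewrite psiE /= ss1.2// ss2.2// mulrBr.
pose E v := range (fun z => psi (z + v) - psi z).
have Eneq0 v : E v !=set0 by exists (psi (0 + v) - psi 0), 0.
have Eub v : ubound (E v) (s1 v + s2 (- v)).
  move=> _ [z _ <-]; rewrite psiE /=.
  have := ss1.1 z v; have := ss2.1 (z + v) (- v); rewrite addrK.
  by lra.
have leE v z : psi (z + v) - psi z <= sup (E v).
  by apply: ub_le_sup; [exists (s1 v + s2 (- v))|exists z].
have Ele v c : (forall z, psi (z + v) - psi z <= c) -> sup (E v) <= c.
  by move=> H; apply: sup_le_ub => // _ [z _ <-].
have psi0 : psi 0 = 0 by rewrite -(scale0r 0) psiZ// mul0r.
exists (fun v => sup (E v)); split.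
- split; last first.
    exists (L1 + L2) => v; apply: (@le_trans _ _ (s1 v + s2 (- v))).
      exact: sup_le_ub.
    by rewrite mulrDl lerD// -[in leRHS]normrN.
  apply: sublinearW.
  + apply/eqP; rewrite eq_le; apply/andP; split.
      by apply: Ele => z; rewrite addr0 subrr.
    by have := leE 0 0; rewrite addr0 subrr.
  + move=> u v; apply: Ele => z; have := leE u z; have := leE v (z + u).
    by rewrite -addrA; lra.
  + move=> t v t0; apply: Ele => z; have := leE v (t^-1 *: z).
    rewrite -(ler_pM2l t0); apply: le_trans.
    by rewrite mulrBr -!(psiZ _ _ (ltW t0)) scalerDr scalerKV ?gt_eqF.
- by move=> v; have := leE v 0; rewrite add0r psi0 subr0.
- move=> v; rewrite -ereal_sup_EFin//; last by exists (s1 v + s2 (- v)).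
  by apply: ge_ereal_sup => _ [_ [z _ <-] <-]; exact: limf_esup_diff_quot.
Qed.

(** The only property of a subdifferential [A] that the argument uses: it
    contains every linear minorant of some sublinear [S] lying above the
    directional derivative. In this form the sum and multiple rules involve no
    limit superior. *)
Definition subdiff_majorant phi x A : Prop := exists S,
  [/\ sublinear S, forall p, linear p -> (forall v, p v <= S v) -> A p
    & forall v, exists2 l, diff_quot phi x v t @[t --> 0^'+] --> l & l <= S v].

(** The sandwich theorem splits a linear [p] below [S + T] as [q + (p - q)],
    where [q] is below [S] and [p - q] below [T]. *)
Lemma subdiff_majorantD phi1 phi2 x A B : subdiff_majorant phi1 x A ->
  subdiff_majorant phi2 x B -> subdiff_majorant (phi1 \+ phi2) x (set_add A B).
Proof.
move=> [S [sS SA dS]] [T [sT TB dT]]; exists (S \+ T); split.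
- split=> [u v|t v t0] /=; first by rewrite addrACA lerD ?sS.1 ?sT.1.
  by rewrite sS.2// sT.2// mulrDr.
- move=> p lp pST.
  have pD u v : p (u + v) = p u + p v.
    by rewrite -[p]/(pack_linear lp : _ -> _) linearD.
  have pZ t u : p (t *: u) = t * p u.
    by rewrite -[p]/(pack_linear lp : _ -> _) linearZ.
  have p0 : p 0 = 0 by rewrite -(scale0r 0) pZ mul0r.
  have [|||||q [lq qS qT]] := @linear_sandwich _ _ S (fun w => T w - p w) setT sS.
  + by split.
  + by move=> u v _ _; rewrite pD; have := sT.1 u v; lra.
  + by move=> t v t0 _; rewrite pZ (sT.2 _ _ (ltW t0)) mulrBr.
  + by rewrite (sublinear0 sT) p0 subr0.
  + by move=> w _; have := pST w; rewrite /=; lra.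
  exists q; first exact: SA.
  exists (p - q); last by rewrite addrC subrK.
  apply: TB => [t u v|v].
    rewrite !fctE lp lq scalerBr; move: (p u) (q u) (p v) (q v) => a b c d.
    by rewrite opprD addrACA.
  have := qT v I; rewrite linear_oppE// => qTv.
  by rewrite -subr_ge0 !fctE; move: qTv; rewrite -subr_ge0 opprK; congr (_ <= _); lra.
- move=> v; have [l cl lS] := dS v; have [m cm mT] := dT v.
  exists (l + m); last exact: lerD.
  by rewrite diff_quotD; exact: cvgD.
Qed.

Lemma subdiff_majorantZ c phi x A : 0 < c -> subdiff_majorant phi x A ->
  subdiff_majorant (fun y => c * phi y) x (set_scale c A).
Proof.
move=> c0 [S [sS SA dS]]; exists (fun v => c * S v); split.
- split=> [u v|t v t0]; first by rewrite -mulrDr ler_pM2l// sS.1.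
  by rewrite sS.2// mulrCA.
- move=> p lp pS; exists (c^-1 *: p); last by rewrite scalerA mulfV ?gt_eqF// scale1r.
  apply: SA => [t u v|v].
    by rewrite !fctE lp scalerDr !scalerA mulrC.
  by rewrite fctE /GRing.scale/= mulrC ler_pdivrMr// mulrC.
- move=> v; have [l cl lS] := dS v; exists (c * l); last by rewrite ler_pM2l.
  rewrite (_ : diff_quot _ _ _ = (fun t => c * diff_quot phi x v t)).
    by apply: cvgM => //; exact: cvg_cst.
  by apply/funext => t; rewrite /diff_quot /= -mulrBr mulrA.
Qed.

(** At a minimum point of [phi + sigma * `|. - x|] the directional derivative,
    hence [S], is at least [- sigma * `|v|]; a linear functional between the two
    lies in [A] and has norm at most [sigma]. *)
Lemma subdiff_majorant_dist phi x A sigma : subdiff_majorant phi x A ->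
  0 <= sigma -> (forall z, phi x <= phi z + sigma * `|z - x|) ->
  (dual_dist 0%R A <= sigma%:E)%E.
Proof.
move=> [S [sS SA dS]] sig0 xmin.
have [|||||p [lp pS pN]] :=
    @linear_sandwich _ _ S (fun w => sigma * `|w|) setT sS.
- by split.
- by move=> u v _ _; rewrite -mulrDr ler_wpM2l// ler_normD.
- by move=> t v t0 _; rewrite normrZ gtr0_norm// mulrCA.
- by rewrite normr0 mulr0.
- move=> w _; have [l cl lS] := dS w; rewrite -lerBlDr sub0r (le_trans _ lS)//.
  apply: (cvgr_to_ge cl); near=> t.
  have t0 : 0 < t by near: t; exact: nbhs_right_gt.
  rewrite /diff_quot ler_pdivlMr//; have := xmin (x + t *: w).
  by rewrite (addrC x) addrK normrZ (gtr0_norm t0); lra.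
apply: (@le_trans _ _ (dual_norm (0 - p))).
  by apply: ereal_inf_lbound; exists p => //; exact: SA.
apply: ge_ereal_sup => _ [v /= v1 <-]; rewrite lee_fin.
have -> : (0 - p) v = - p v by rewrite !fctE sub0r.
rewrite normrN (@le_trans _ _ (sigma * `|v|))//; last by rewrite ler_piMr.
apply: dominated_norm => // w.
by have := pN (- w) I; rewrite opprK normrN.
Unshelve. all: by end_near. Qed.

End ClarkeSubdifferential.

(** The Clarke subdifferential at the origin contains every linear minorant of a
    continuous functional below the Clarke derivative, and
    [sublinear_diff_clarke] provides such a functional above the directional
    derivative. *)
Lemma quasidifferentiable_subdiff_majorant (R : realType)
    (X : completeNormedModType R) (phi : X -> R) (x : X) :
  quasidifferentiable phi x ->
  subdiff_majorant phi x (demyanov_quasidiff phi x).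
Proof.
move=> [A [B qAB]]; have [cA cB dphi dphiE] := qAB.
rewrite (demyanov_quasidiffE qAB).
have [S [[sS [L SL]] psiS SC]] : exists S, [/\ bounded_sublinear S,
    forall v, support_fun v A - support_fun v B <= S v
  & forall v, ((S v)%:E <=
      clarke_derive (fun v => support_fun v A - support_fun v B)%R 0%R v)%E].
  apply: sublinear_diff_clarke; exists (support_fun ^~ A), (support_fun ^~ B).
  by split=> //; exact: support_fun_bounded_sublinear.
exists S; split=> // [p lp pS|v].
  split; first by apply: (@dominated_dual _ _ p L) => // v; exact: le_trans (pS v) _.
  by move=> v; apply: le_trans (SC v); rewrite lee_fin.
exists (support_fun v A - support_fun v B) => //.
by rewrite -dphiE; exact: dphi.
Qed.

(** * Lower semicontinuous functions *)

Section LowerSemicontinuity.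
Context {R : realType} {X : normedModType R}.
Implicit Types (phi psi : X -> R) (x y : X).

Lemma lsc_near {phi x e} : lower_semicontinuous (EFin \o phi) -> 0 < e ->
  \forall y \near x, phi x < phi y + e.
Proof.
move=> lphi e0; have [|V Vx Vphi] := lphi x (phi x - e).
  by rewrite lte_fin ltrBlDr ltrDl.
by apply: filterS Vx => y /Vphi; rewrite lte_fin ltrBlDr.
Qed.

Lemma near_lsc phi :
  (forall x e, 0 < e -> \forall y \near x, phi x < phi y + e) ->
  lower_semicontinuous (EFin \o phi).
Proof.
move=> H x a; rewrite lte_fin => aphi.
exists [set y | phi x < phi y + (phi x - a)]; first by apply: H; rewrite subr_gt0.
by move=> y /=; rewrite lte_fin; lra.
Qed.

Lemma lscD phi psi : lower_semicontinuous (EFin \o phi) ->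
  lower_semicontinuous (EFin \o psi) ->
  lower_semicontinuous (EFin \o (phi \+ psi)).
Proof.
move=> lphi lpsi; apply: near_lsc => x e e0.
have e20 : 0 < e / 2 by rewrite divr_gt0.
by apply: filterS2 (lsc_near lphi e20) (lsc_near lpsi e20) => y /=; lra.
Qed.

Lemma lscZ c phi : 0 < c -> lower_semicontinuous (EFin \o phi) ->
  lower_semicontinuous (EFin \o (fun x => c * phi x)).
Proof.
move=> c0 lphi; apply: near_lsc => x e e0.
have ec0 : 0 < e / c by rewrite divr_gt0.
apply: filterS (lsc_near lphi ec0) => y /=.
by rewrite -(ltr_pM2l c0) mulrDr (mulrC c (e / c)) divfK// gt_eqF.
Qed.

Lemma lsc_pos_part phi : lower_semicontinuous (EFin \o phi) ->
  lower_semicontinuous (EFin \o pos_part phi).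
Proof.
move=> lphi; apply: near_lsc => x e e0.
apply: filterS (lsc_near lphi e0) => y /=; rewrite /pos_part gt_max => H.
rewrite (lt_le_trans H) ?lerD2r ?le_max ?lexx//=.
by rewrite (lt_le_trans e0)// lerDr le_max lexx orbT.
Qed.

Lemma continuous_lsc phi : continuous phi -> lower_semicontinuous (EFin \o phi).
Proof.
move=> cphi; apply: near_lsc => x e e0.
have := cphi x; move=> /cvgrPdist_lt /(_ e e0).
by apply: filterS => y; rewrite ltr_distlC => /andP[]; lra.
Qed.

End LowerSemicontinuity.

(** * Ekeland's variational principle and error bounds *)

Section Ekeland.
Context {R : realType} {X : completeNormedModType R}.
Implicit Types (phi : X -> R) (x y z : X).

(** [below y z] is the Bishop-Phelps order attached to [phi] and [sigma]. A
    sequence descending in this order, each term nearly minimising [phi] among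
    the points below the previous one, is Cauchy; lower semicontinuity keeps its
    limit below every term, and near-minimality leaves nothing strictly below
    the limit. *)
Lemma ekeland phi m sigma x : lower_semicontinuous (EFin \o phi) ->
    (forall y, m <= phi y) -> 0 < sigma ->
  exists y, phi y + sigma * `|y - x| <= phi x /\
    forall z, phi y <= phi z + sigma * `|z - y|.
Proof.
move=> lphi mphi s0.
pose below y z := phi z + sigma * `|z - y| <= phi y.
have below_refl y : below y y by rewrite /below subrr normr0 mulr0 addr0.
have below_trans y z w : below y z -> below z w -> below y w.
  rewrite /below => yz zw; rewrite (le_trans _ yz)// -(lerD2r (- (sigma * `|z - y|))) addrK.
  rewrite (le_trans _ zw)// -addrA lerD2l -mulrBr ler_pM2l// lerBlDr.
  by rewrite (le_trans _ (ler_normD _ _))// addrA subrK.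
have step y n : exists z,
    below y z /\ forall w, below y w -> phi z <= phi w + n.+1%:R^-1.
  pose E := [set phi w | w in below y].
  have Einf : has_inf E.
    by split; [exists (phi y), y|exists m => _ [w _ <-]].
  have [|_ [z yz <-] zE] := @inf_adherent _ E n.+1%:R^-1 _ Einf.
    by rewrite invr_gt0.
  exists z; split=> // w yw; rewrite (le_trans (ltW zE))// lerD2r.
  by apply: ge_inf; [exact: Einf.2|exists w].
have [F HF] := choice (fun yn : X * nat => step yn.1 yn.2).
pose u := fix u n := if n is n'.+1 then F (u n', n') else x.
have uS n : below (u n) (u n.+1) by have [] := HF (u n, n).
have umin n w : below (u n) w -> phi (u n.+1) <= phi w + n.+1%:R^-1.
  by have [_] := HF (u n, n); apply.
have ule n k : (n <= k)%N -> below (u n) (u k).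
  elim: k => [|k IH]; first by rewrite leqn0 => /eqP ->.
  rewrite leq_eqVlt => /predU1P[->//|/IH nk]; exact: below_trans nk (uS k).
have phiu_mono : {homo phi \o u : n k / (n <= k)%N >-> k <= n}.
  by move=> n k nk /=; rewrite (le_trans _ (ule _ _ nk))// lerDl mulr_ge0// ltW.
have phiu_cvg : cvgn (phi \o u).
  apply: nonincreasing_is_cvgn => //; by exists m => _ [n _ <-]; exact: mphi.
have u_cvg : cvgn u.
  apply: cauchy_cvg; apply: cauchy_exP => e e0.
  have se0 : 0 < sigma * e by exact: mulr_gt0.
  have phiu_ge k : limn (phi \o u) <= phi (u k).
    by apply: (nonincreasing_cvgn_ge phiu_mono phiu_cvg).
  have /cvgrPdist_lt/(_ _ se0)[N _ HN] : phi \o u @ \oo --> limn (phi \o u) by [].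
  exists (u N); exists N => // k Nk; rewrite -ball_normE /= -(ltr_pM2l s0) distrC.
  have := ule _ _ Nk; have := phiu_ge k; have := HN N (leqnn N).
  by rewrite /= /below ltr_distlC => /andP[]; lra.
pose y := limn u.
have yu n : below (u n) y.
  rewrite /below leNgt; apply/negP; rewrite -subr_gt0.
  set d := _ - _ => d0.
  have d20 : 0 < d / 2 by rewrite divr_gt0.
  have d2s0 : 0 < d / 2 / sigma by rewrite divr_gt0.
  near \oo => k.
  have nk : (n <= k)%N by near: k; exact: nbhs_infty_ge.
  have phik : phi y < phi (u k) + d / 2.
    by near: k; exact: (u_cvg _ (lsc_near lphi d20)).
  have : `|y - u k| < d / 2 / sigma.
    by near: k; apply: (cvgrPdist_lt _ _).1 d2s0.
  rewrite ltr_pdivlMr// mulrC => yk.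
  have tri : sigma * `|y - u n| <= sigma * `|y - u k| + sigma * `|u k - u n|.
    by rewrite -mulrDr ler_pM2l// (le_trans _ (ler_normD _ _))// addrA subrK.
  by have := ule _ _ nk; rewrite /below; move: d0 phik yk tri; rewrite /d; lra.
exists y; split; first exact: (yu 0%N).
move=> z; rewrite leNgt; apply/negP => zy.
have uz n : below (u n) z by apply: below_trans (yu n) _; rewrite /below ltW.
have : phi y <= phi z.
  apply/ler_addgt0Pr => e e0.
  have [n ne] : exists n, n.+1%:R^-1 < e.
    near \oo => n; exists n; near: n; exact: near_infty_natSinv_lt (PosNum e0).
  rewrite (@le_trans _ _ (phi (u n.+1)))//.
    by rewrite (le_trans _ (yu n.+1))// lerDl mulr_ge0// ltW.
  by rewrite (le_trans (umin _ _ (uz n)))// lerD2l ltW.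
rewrite leNgt => /negP; apply; apply: le_lt_trans zy.
by rewrite lerDl mulr_ge0// ltW.
Unshelve. all: by end_near. Qed.

(** For [sigma < tau] the principle started at [x] gives a point [y] that has to
    be in [S], at distance at most [(phi x - m) / sigma] from [x]; then [sigma]
    tends to [tau]. *)
Lemma error_bound phi m tau (S : set X) : lower_semicontinuous (EFin \o phi) ->
    (forall y, m <= phi y) -> 0 < tau ->
    (forall y sigma, ~ S y -> 0 < sigma < tau ->
      ~ (forall z, phi y <= phi z + sigma * `|z - y|)) ->
  forall x, (tau%:E * dist_set x S <= (phi x - m)%:E)%E.
Proof.
move=> lphi mphi tau0 crit x.
have step sigma : 0 < sigma < tau -> exists2 a, S a & sigma * `|x - a| <= phi x - m.
  move=> /andP[s0 st].
  have [y [yx ymin]] := ekeland x lphi mphi s0.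
  have Sy : S y by apply: contrapT => nSy; apply: (crit y sigma nSy) ymin; rewrite s0.
  by exists y => //; rewrite distrC; have := mphi y; lra.
have dle sigma : 0 < sigma < tau -> (sigma%:E * dist_set x S <= (phi x - m)%:E)%E.
  move=> s0; have [a Sa ale] := step _ s0; move: s0 => /andP[s0 st].
  apply: le_trans (_ : (sigma%:E * `|x - a|%:E <= _)%E) => //.
  rewrite lee_pmul2l ?lte_fin//.
  by apply: ereal_inf_lbound; exists a.
have tau2 : 0 < tau / 2 < tau by lra.
have [a Sa _] := step _ tau2.
have d_fin : dist_set x S \is a fin_num.
  rewrite ge0_fin_numE; last by apply: le_ereal_inf_tmp => _ [b _ <-]; rewrite lee_fin.
  by apply: le_lt_trans (ltry `|x - a|); apply: ereal_inf_lbound; exists a.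
have d_ge0 : (0 <= dist_set x S)%E.
  by apply: le_ereal_inf_tmp => _ [b _ <-]; rewrite lee_fin.
move: dle; rewrite -(fineK d_fin) in d_ge0 *.
move: (fine _) d_ge0 => d; rewrite lee_fin => d0 dle.
rewrite -EFinM lee_fin leNgt; apply/negP => H.
have phim : 0 <= phi x - m by rewrite subr_ge0.
have dpos : 0 < d.
  by rewrite lt_neqAle d0 andbT; apply/eqP => dE; move: H; rewrite -dE mulr0; lra.
(* any value strictly between [(phi x - m) / d] and [tau] contradicts [dle] *)
pose sigma := ((phi x - m) / d + tau) / 2.
have q_lt : (phi x - m) / d < tau by rewrite ltr_pdivrMr.
have q0 : 0 <= (phi x - m) / d by rewrite divr_ge0.
have /dle : 0 < sigma < tau by rewrite /sigma; lra.
rewrite -EFinM lee_fin -ler_pdivlMr// /sigma; lra.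
Qed.
End Ekeland.

(** * Exact penalisation and weak sharp minimizers *)

(** Critical points in the sense of [error_bound] are excluded outside [S] by
    [subdiff_majorant_dist]. *)
Lemma subdiff_error_bound (R : realType) (X : completeNormedModType R)
    (phi : X -> R) (A : X -> set (X -> R^o)) (m tau : R) (S : set X) :
  lower_semicontinuous (EFin \o phi) -> (forall y, m <= phi y) ->
  (forall y, subdiff_majorant phi y (A y)) -> 0 < tau ->
  (tau%:E <= ereal_inf [set dual_dist 0%R (A y) | y in ~` S])%E ->
  forall x, (tau%:E * dist_set x S <= (phi x - m)%:E)%E.
Proof.
move=> lphi mphi majA tau0 slope; apply: error_bound => //.
move=> y sigma nSy /andP[s0 st] ymin.
have := subdiff_majorant_dist (majA y) (ltW s0) ymin.
apply/negP; rewrite -ltNge (lt_le_trans (_ : (sigma%:E < tau%:E)%E)) ?lte_fin//.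
by apply: le_trans slope _; apply: ereal_inf_lbound; exists y.
Qed.

(** A Lipschitz function loses at most [lf * dist x Omega] when leaving [Omega],
    which the error bound for [r] shows to be compensated by the penalty. *)
Lemma exact_penalty (R : realType) (X : normedModType R)
    (f r : X -> R) (lf c tau : R) (Omega : set X) (x0 : X) :
  Argmin f Omega x0 -> lf.-lipschitz f -> 0 <= lf -> 0 < tau -> lf <= c * tau ->
  (forall x, (tau%:E * dist_set x Omega <= (r x)%:E)%E) ->
  forall x, f x0 <= f x + c * r x.
Proof.
move=> [Ox0 fmin] f_lip lf0 tau0 lfc rx x.
have c0 : 0 <= c by rewrite -(pmulr_lge0 _ tau0) (le_trans lf0).
have f_le a : Omega a -> f x0 - f x <= lf * `|x - a|.
  move=> Oa; have : `|f x - f a| <= lf * `|x - a| by exact: f_lip (x, a) (conj I I).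
  by have := fmin a Oa; rewrite ler_norml => ? /andP[]; lra.
have flip : ((f x0 - f x)%:E <= lf%:E * dist_set x Omega)%E.
  move: lf0; rewrite le_eqVlt => /predU1P[lf0|lf0].
    by rewrite -lf0 mul0e lee_fin (le_trans (f_le x0 Ox0))// -lf0 mul0r.
  rewrite -ereal_inf_pZl//; apply: le_ereal_inf_tmp => _ [_ [a Oa <-] <-].
  by rewrite -EFinM lee_fin f_le.
rewrite addrC -lerBlDr -lee_fin (le_trans flip)//.
apply: (@le_trans _ _ (c%:E * (tau%:E * dist_set x Omega)%E)%E).
  rewrite muleA -EFinM lee_wpmul2r ?lee_fin//.
  by apply: le_ereal_inf_tmp => _ [b _ <-]; rewrite lee_fin.
by rewrite EFinM lee_wpmul2l ?lee_fin.
Qed.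

Theorem theorem4p4 (R : realType) (X : completeNormedModType R)
  (f g h : X -> R) (lf tau lambda zeta : R)
  (f_qdiff : forall x : X, quasidifferentiable f x)
  (g_qdiff : forall x : X, quasidifferentiable g x)
  (h_qdiff : forall x : X, quasidifferentiable h x)
  (f_lsc : lower_semicontinuous (EFin \o f))
  (g_lsc : lower_semicontinuous (EFin \o g))
  (h_cont : continuous h)
  (f_bounded_below : has_lbound (range f))
  (argmin_neq0 : Argmin f (feasible g h) !=set0)
  (tau_gt0 : 0 < tau)
  (slope_constraint :
    (tau%:E <= ereal_inf
      [set dual_dist 0%R
             (set_add (demyanov_quasidiff (pos_part g) x)
                      (demyanov_quasidiff (abs_fun h) x))
         | x in ~` feasible g h])%E)
  (f_lipschitz : lf.-lipschitz f)
  (lambda_gt : lf < lambda)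
  (zeta_gt0 : 0 < zeta)
  (slope_penalized :
    (zeta%:E <= ereal_inf
      [set dual_dist 0%R
             (set_add (demyanov_quasidiff f x)
                (set_scale (lambda * tau^-1)
                   (set_add (demyanov_quasidiff (pos_part g) x)
                            (demyanov_quasidiff (abs_fun h) x))))
         | x in ~` Argmin f (feasible g h)])%E) :
  weak_sharp_minimizers f (feasible g h) /\
  (zeta%:E <= wsha f (feasible g h))%E.
Proof.
suff zeta_sharp : sharp_moduli f (feasible g h) zeta.
  split; first by split=> //; exists zeta.
  by apply: ereal_sup_ubound; exists zeta.
split=> // x Ox; have [x0 x0min] := argmin_neq0; have [Ox0 fmin] := x0min.
have -> : ereal_inf [set (f z)%:E | z in feasible g h] = (f x0)%:E.
  apply/eqP; rewrite eq_le ereal_inf_lbound/=; last by exists x0.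
  by apply: le_ereal_inf_tmp => _ [z /fmin + <-]; rewrite lee_fin.
rewrite -EFinB.
have f_lip u v : `|f u - f v| <= lf * `|u - v| by exact: f_lipschitz (u, v) (conj I I).
have [lf_lt0|lf0] := ltP lf 0.
  (* a negative rank forces all points to coincide *)
  have -> : x = x0.
    apply/eqP; rewrite -subr_eq0 -normr_le0 -(ler_nM2l lf_lt0) mulr0.
    by rewrite (le_trans _ (f_lip x x0)).
  rewrite subrr; apply: mule_ge0_le0; first by rewrite lee_fin ltW.
  by apply: ereal_inf_lbound; exists x0 => //; rewrite subrr normr0.
pose r := pos_part g \+ abs_fun h.
have r_lsc : lower_semicontinuous (EFin \o r).
  apply: lscD; first exact: lsc_pos_part.
  apply: continuous_lsc => z; apply: cvg_norm; exact: h_cont.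
have r_maj z := subdiff_majorantD
  (quasidifferentiable_subdiff_majorant (quasidifferentiable_pos_part (g_qdiff z)))
  (quasidifferentiable_subdiff_majorant (quasidifferentiable_abs_fun (h_qdiff z))).
have r_ge0 z : 0 <= r z.
  by apply: addr_ge0; [rewrite /pos_part le_max lexx orbT|exact: normr_ge0].
have r_bound z : (tau%:E * dist_set z (feasible g h) <= (r z)%:E)%E.
  by rewrite -[r z]subr0; exact: subdiff_error_bound r_lsc r_ge0 r_maj tau_gt0
    slope_constraint z.
pose c := lambda * tau^-1.
have c0 : 0 < c by rewrite divr_gt0// (le_lt_trans lf0).
pose phi := f \+ (fun z => c * r z).
have lf_c : lf <= c * tau by rewrite /c divfK ?gt_eqF// ltW.
have phi_ge z : f x0 <= phi z.
  exact: exact_penalty x0min f_lipschitz lf0 tau_gt0 lf_c r_bound z.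
have phi_lsc : lower_semicontinuous (EFin \o phi) by apply: lscD => //; exact: lscZ.
have phi_maj z := subdiff_majorantD
  (quasidifferentiable_subdiff_majorant (f_qdiff z)) (subdiff_majorantZ c0 (r_maj z)).
have := subdiff_error_bound phi_lsc phi_ge phi_maj zeta_gt0 slope_penalized x.
suff -> : phi x = f x by [].
have [gx hx] := Ox.
by rewrite /phi /r /= /pos_part /abs_fun hx normr0 max_r// addr0 mulr0 addr0.
Qed.
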